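(* Let $G$ be a well-founded chess-like game on a game tree $(V,E)$ with set of leaves $Z$. Then $$\mathit{SPE}(G)=\{s\in S\mid \forall w\in V\setminus Z\ \exists i\in\{1,2\}\ [\,s^w\in (\mathit{win}_i(G^w)\times S^w_{-i})\cup(\mathit{draw}_i(G^w)\times\mathit{draw}_{-i}(G^w))\,]\}.$$
   Context: A two-player extensive game with perfect information is $G=(T,\mathit{turn},p_1,p_2)$, where $T=(V,E)$ is a (possibly infinite) rooted tree with edges directed away from the root and set of leaves $Z$, $\mathit{turn}:V\setminus Z\to\{1,2\}$ says who moves at each non-leaf node, and $p_i:Z\to\mathbb{R}$ is the payoff function of player $i$. The game is well-founded if $T$ has no infinite paths. The opponent of player $i$ is denoted $-i$. A strategy of player $i$ is a function $s_i$ assigning to each non-leaf node $u$ with $\mathit{turn}(u)=i$ a child of $u$; $S_i$ is the set of these strategies, and $S=S_1\times S_2$ is the set of joint strategies. In a well-founded game, following a joint strategy $s$ from the root leads to a unique leaf, denoted $\mathit{leaf}(s)$. A joint strategy $s$ is a Nash equilibrium if for all players $i$ and all $s'_i\in S_i$, $p_i(\mathit{leaf}(s_i,s_{-i}))\ge p_i(\mathit{leaf}(s'_i,s_{-i}))$. For a node $w$, the subgame $G^w$ has the same players, the subtree $T^w$ of $T$ rooted at $w$, and the restrictions of $\mathit{turn}$ and the payoff functions to $T^w$; $S_i^w$ is the set of strategies of player $i$ in $G^w$, and $s^w$ is the restriction of $s$ to $G^w$. A joint strategy $s$ is a subgame perfect equilibrium of $G$ if for every node $w$ of $T$, $s^w$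 is a Nash equilibrium in $G^w$. $\mathit{SPE}(G)$ is the set of subgame perfect equilibria of $G$. A chess-like game is a two-player well-founded extensive game in which the only possible outcomes (values of $(p_1,p_2)$ at leaves) are $(1,-1)$, $(0,0)$ and $(-1,1)$. $\mathit{win}_i(G)$ is the set of winning strategies of player $i$, i.e. of $s_i\in S_i$ such that $p_i(\mathit{leaf}(s_i,s_{-i}))=1$ for all $s_{-i}\in S_{-i}$. $\mathit{draw}_i(G)$ is the set of $s_i\in S_i$ such that $p_i(\mathit{leaf}(s_i,s_{-i}))\ge 0$ for all $s_{-i}\in S_{-i}$. In products such as $\mathit{win}_i(G^w)\times S^w_{-i}$ the first factor is the component of player $i$ and the second that of player $-i$; they are regarded as sets of joint strategies. *)

(* Defs.v *)
From mathcomp Require Import all_boot all_order all_algebra.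
From mathcomp Require Import boolp classical_sets reals.

Set Implicit Arguments.
Unset Strict Implicit.
Unset Printing Implicit Defensive.

Import Order.TTheory GRing.Theory Num.Theory.
Local Open Scope classical_set_scope.
Local Open Scope ring_scope.

Inductive player := P1 | P2.

Definition opponent (i : player) : player :=
  match i with P1 => P2 | P2 => P1 end.

Section Trees.
Variables (V : Type) (E : rel V).

Definition is_leaf (v : V) : Prop := forall u, ~~ E v u.

(* A directed walk from [x] to [y] is given by the list [p] of the nodes
   that come after [x]. *)
Definition is_walk (x y : V) (p : seq V) : Prop := path E x p /\ last x p = y.

(* Uniqueness is over all walks, not only those without repeated nodes: this
   is what excludes cycles. *)
Definition rooted_tree (r : V) : Prop := forall v, exists! p, is_walk r v p.

Definition descendant (w v : V) : Prop := exists p, is_walk w v p.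

Definition no_infinite_path : Prop :=
  ~ exists f : nat -> V, forall n, E (f n) (f n.+1).

End Trees.

Record game (R : realType) := Game {
  node : Type;
  edge : rel node;
  root : node;
  game_tree : rooted_tree edge root;
  turn : {v | ~ is_leaf edge v} -> player;
  payoff : player -> {z | is_leaf edge z} -> R
}.

Arguments edge {R} g.

Section Games.
Variables (R : realType) (G : game R).

Definition leafnode : Type := {z : node G | is_leaf (edge G) z}.
Definition inner : Type := {v : node G | ~ is_leaf (edge G) v}.
Definition child (u : inner) : Type := {v : node G | edge G (sval u) v}.

Definition strategy (i : player) : Type :=
  forall u : inner, turn u = i -> child u.

Definition joint : Type := forall i, strategy i.

(* The joint strategy (s_i, s_{-i}). *)
Definition join (i : player) : strategy i -> strategy (opponent i) -> joint :=
  match i with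
  | P1 => fun a b j => match j with P1 => a | P2 => b end
  | P2 => fun a b j => match j with P1 => b | P2 => a end
  end.

(* A x B, with A the component of player i and B that of player -i, seen as a
   set of joint strategies. *)
Definition joint_prod (i : player)
    (A : set (strategy i)) (B : set (strategy (opponent i))) : set joint :=
  [set s | A (s i) /\ B (s (opponent i))].

(* One move according to [s]; leaves are fixed points. *)
Definition move (s : joint) (v : node G) : node G :=
  match pselect (is_leaf (edge G) v) with
  | left _ => v
  | right nl => sval (s (turn (exist _ v nl)) (exist _ v nl) erefl)
  end.

Definition play (s : joint) (n : nat) : node G := iter n (move s) (root G).

Definition well_founded_game : Prop := no_infinite_path (edge G).

Lemma play_reaches_leaf (s : joint) :
  well_founded_game -> exists n, is_leaf (edge G) (play s n).
Proof.
move=> wfG; apply: contrapT => noleaf; apply: wfG; exists (play s) => n.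
rewrite /play iterS -/(play s n) /move.
case: pselect => [lf|nl]; first by case: noleaf; exists n.
by case: (s _ _ _).
Qed.

End Games.

Record wf_game (R : realType) := WfGame {
  wf_base :> game R;
  wf_axiom : well_founded_game wf_base
}.

Arguments wf_axiom {R} w.

Section Subgame.
Variables (R : realType) (G : game R) (w : node G).

Definition subnode : Type := {v : node G | descendant (edge G) w v}.
Definition subedge : rel subnode := fun x y => edge G (sval x) (sval y).

Lemma descendant_refl : descendant (edge G) w w.
Proof. by exists [::]. Qed.

Definition subroot : subnode := exist _ w descendant_refl.

Lemma descendant_edge (v u : node G) :
  descendant (edge G) w v -> edge G v u -> descendant (edge G) w u.
Proof.
move=> [p [pp lp]] vu; exists (rcons p u); split; last by rewrite last_rcons.
by rewrite rcons_path pp lp.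
Qed.

Lemma subnode_inj (x y : subnode) : sval x = sval y -> x = y.
Proof. by case: x y => [x hx] [y hy] /= xy; exact: eq_exist. Qed.

Lemma subgame_tree : rooted_tree subedge subroot.
Proof.
have walk_sval (x : subnode) (p : seq subnode) :
    path subedge x p -> path (edge G) (sval x) (map sval p).
  by elim: p x => //= y p IH x /andP[xy yp]; rewrite [edge _ _ _]xy /=; apply: IH.
have lift_walk (x : subnode) (p : seq (node G)) : path (edge G) (sval x) p ->
    exists2 q : seq subnode, path subedge x q & map sval q = p.
  elim: p x => [|y p IH] x /=; first by exists [::].
  move=> /andP[xy yp].
  have dy := descendant_edge (svalP x) xy.
  have [q qq qp] := IH (exist _ y dy) yp.
  by exists (exist _ y dy :: q) => /=; [rewrite /subedge /= xy|rewrite qp].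
move=> v; have [p [pp lp]] := svalP v.
have [q qq qp] := lift_walk subroot p pp.
exists q; split.
  split=> //; apply: subnode_inj.
  by rewrite -lp -qp (last_map sval q subroot).
move=> q' [qq' lq'].
have [t [[tt lt] _]] := @game_tree _ G w.
have [r [_ ur]] := @game_tree _ G (sval v).
have cat_walk (a : seq subnode) : path subedge subroot a ->
    last w (map sval a) = sval v ->
    is_walk (edge G) (root G) (sval v) (t ++ map sval a).
  move=> /walk_sval aa la; split; last by rewrite last_cat lt.
  by rewrite cat_path tt lt.
have e1 := ur _ (cat_walk q qq (etrans (congr1 (last w) qp) lp)).
have e2 : r = t ++ map sval q'.
  apply: ur; apply: cat_walk => //.
  by rewrite (last_map sval q' subroot) lq'.
have eqm : map sval q = map sval q'.
  have /(congr1 (drop (size t))) := etrans (esym e1) e2.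
  by rewrite !drop_size_cat.
by apply: inj_map eqm; exact: subnode_inj.
Qed.

Lemma subnode_leaf (x : subnode) :
  is_leaf subedge x <-> is_leaf (edge G) (sval x).
Proof.
split=> lx u; last exact: lx.
apply/negP => xu.
by have := lx (exist _ u (descendant_edge (svalP x) xu)); rewrite /subedge /= xu.
Qed.

Definition inner_up (u : {v | ~ is_leaf subedge v}) : inner G :=
  exist (fun v => ~ is_leaf (edge G) v) (sval (sval u))
    (fun l => svalP u ((subnode_leaf _).2 l)).

Definition leaf_up (z : {v | is_leaf subedge v}) : leafnode G :=
  exist _ (sval (sval z)) ((subnode_leaf _).1 (svalP z)).

Definition subgame : game R :=
  @Game R subnode subedge subroot subgame_tree
    (fun u => turn (inner_up u)) (fun i z => payoff i (leaf_up z)).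

Definition child_down (u : inner subgame) (c : child (inner_up u)) : child u :=
  exist (fun v : node subgame => edge subgame (sval u) v)
    (exist _ (sval c) (descendant_edge (svalP (sval u)) (svalP c))) (svalP c).

Definition restrict (s : joint G) : joint subgame :=
  fun i (u : inner subgame) (ui : turn u = i) =>
    child_down (s i (inner_up u) ui).

Lemma subgame_wf : well_founded_game G -> well_founded_game subgame.
Proof. by move=> wfG [f fE]; apply: wfG; exists (fun n => sval (f n)). Qed.

End Subgame.

Arguments subgame {R} G w.
Arguments restrict {R G} w s i u ui.

Definition wf_subgame (R : realType) (G : wf_game R) (w : node G) : wf_game R :=
  @WfGame R (subgame G w) (subgame_wf (w := w) (wf_axiom G)).

Arguments wf_subgame {R} G w.

Section Equilibria.
Variables (R : realType) (G : wf_game R).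

Definition leaf (s : joint G) : leafnode G :=
  let n := cid (play_reaches_leaf s (wf_axiom G)) in
  exist _ (play s (projT1 n)) (projT2 n).

(* The choice of the number of moves made in [leaf] is irrelevant. *)
Lemma leaf_unique (s : joint G) (n : nat) :
  is_leaf (edge G) (play s n) -> sval (leaf s) = play s n.
Proof.
have stay m k : is_leaf (edge G) (play s m) -> play s (k + m) = play s m.
  move=> lm; elim: k => // k IH; rewrite addSn /play iterS -/(play s _) IH.
  by rewrite /move; case: pselect.
move=> ln; rewrite /leaf /=; case: cid => m lm /=.
by rewrite -(stay m n lm) addnC stay.
Qed.

Definition nash (s : joint G) : Prop :=
  forall (i : player) (si' : strategy G i),
    payoff i (leaf s) >= payoff i (leaf (join si' (s (opponent i)))).

Definition win (i : player) : set (strategy G i) :=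
  [set si | forall sj : strategy G (opponent i),
     payoff i (leaf (join si sj)) = 1].

Definition draw (i : player) : set (strategy G i) :=
  [set si | forall sj : strategy G (opponent i),
     payoff i (leaf (join si sj)) >= 0].

Definition chess_like : Prop :=
  forall z : leafnode G,
    (payoff P1 z, payoff P2 z) \in [:: (1, -1); (0, 0); (-1, 1)].

End Equilibria.

Definition SPE (R : realType) (G : wf_game R) : set (joint G) :=
  [set s | forall w : node G, @nash R (wf_subgame G w) (restrict w s)].

Arguments win {R} G i.
Arguments draw {R} G i.
Arguments SPE {R} G.

(* Main.v *)
Require Import Defs.
From mathcomp Require Import all_boot all_order all_algebra.
From mathcomp Require Import boolp classical_sets reals.
From mathcomp Require Import lra.

(** A chess-like game is zero-sum, so a Nash equilibrium is a saddle point of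
    the payoff of player 1. If its value is 1 or -1 then the strategy of the
    player who gets 1 is winning; if it is 0 then both strategies guarantee a
    draw; and conversely. Hence the two sides agree subgame by subgame, without
    backward induction. *)

Import Order.TTheory GRing.Theory Num.Theory.

Local Open Scope classical_set_scope.
Local Open Scope ring_scope.

Lemma join_eta (R : realType) (G : game R) (s : joint G) (i : player) :
  join (s i) (s (opponent i)) = s.
Proof. by apply: functional_extensionality_dep; case: i => -[]. Qed.

Lemma chess_like_payoff (R : realType) (G : wf_game R) (z : leafnode G) :
  chess_like G ->
  payoff P2 z = - payoff P1 z /\
  [\/ payoff P1 z = 1, payoff P1 z = 0 | payoff P1 z = -1].
Proof.
move=> /(_ z); rewrite !inE !xpair_eqE.
case/or3P=> /andP[/eqP-> /eqP->]; rewrite ?oppr0 ?opprK; split=> //.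
- exact: Or31.
- exact: Or32.
- exact: Or33.
Qed.

Lemma nash_chess_likeP (R : realType) (G : wf_game R) (s : joint G) :
  chess_like G ->
  nash s <->
  exists i, (joint_prod (win G i) setT `|`
             joint_prod (draw G i) (draw G (opponent i))) s.
Proof.
move=> chessG.
have zs (z : leafnode G) : payoff P2 z = - payoff P1 z.
  by have [] := chess_like_payoff _ _ z chessG.
have outcome (z : leafnode G) := (chess_like_payoff _ _ z chessG).2.
have bounds (z : leafnode G) : -1 <= payoff P1 z <= 1.
  by case: (outcome z) => ->; lra.
split=> [nash_s|].
  (* The saddle point: no [a] of player 1 raises the payoff of player 1, and, the game being
     zero-sum, no [b] of player 2 lowers it. *)
  have maxP1 a := nash_s P1 a.
  have minP1 b : payoff P1 (leaf s) <= payoff P1 (leaf (join (i := P1) (s P1) b)).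
    by have := nash_s P2 b; rewrite !zs lerN2.
  case: (outcome (leaf s)) => v.
  (* Against any [b] player 1 still gets at least 1, which is also the largest possible payoff. *)
  - exists P1; left; split=> // b; have := minP1 b.
    by have := bounds (leaf (join (i := P1) (s P1) b)); lra.
  - exists P1; right; split=> [b|a]; first by rewrite -v; apply: minP1.
    by rewrite zs oppr_ge0 -v; apply: maxP1.
  - exists P2; left; split=> // a; rewrite zs; have := maxP1 a.
    by have := bounds (leaf (join (i := P2) (s P2) a)); rewrite /=; lra.
have etaP1 := join_eta _ _ s P1; have etaP2 := join_eta _ _ s P2.
(* The two guarantees applied to [s] itself force the value 0, and each of them caps the deviations
   of the other player at 0. Both choices of [i] reduce to this case. *)
have draws : draw G P1 (s P1) -> draw G P2 (s P2) -> nash s.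
  move=> d1 d2.
  have := d1 (s P2); have := d2 (s P1); rewrite etaP1 etaP2 zs => v1 v2.
  by case=> t; [have := d2 t|have := d1 t]; rewrite !zs /=; lra.
case=> -[] [[+ _]|[]] => [w1|d1 d2|w2|d2 d1]; try exact: draws.
(* The winner already has the maximum, and no deviation of the loser changes the outcome. *)
- have := w1 (s P2); rewrite etaP1 => v.
  case=> t; rewrite ?zs v; last by have := w1 t; rewrite /= => ->.
  by have /andP[] := bounds (leaf (join (i := P1) t (s P2))).
- have := w2 (s P1); rewrite etaP2 => v.
  case=> t; first by have := w2 t; move: v; rewrite !zs /=; lra.
  by rewrite v zs lerNl; have /andP[] := bounds (leaf (join (i := P2) t (s P1))).
Qed.

(** Bridges the quantifier over all nodes in [SPE] and the one over non-leaves in the theorem: with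
    no move to make, every joint strategy ends at the root, so deviations change nothing. *)
Lemma nash_root_leaf (R : realType) (G : wf_game R) (s : joint G) :
  is_leaf (edge G) (Defs.root G) -> nash s.
Proof.
move=> lr i t; suff -> : leaf (join t (s (opponent i))) = leaf s by [].
have leaf_root t' : sval (leaf t') = Defs.root G := leaf_unique (n := 0) lr.
by apply: eq_sig_hprop => [z p q|]; [exact: Prop_irrelevance|rewrite !leaf_root].
Qed.

Lemma chess_like_subgame (R : realType) (G : wf_game R) (w : node G) :
  chess_like G -> chess_like (wf_subgame G w).
Proof. by move=> chessG z; apply: chessG. Qed.

Theorem corollary19 (R : realType) (G : wf_game R) (chessG : chess_like G) :
  SPE G =
  [set s : joint G |
     forall w : node G, ~ is_leaf (edge G) w ->
     exists i : player,
       (joint_prod (win (wf_subgame G w) i) setT `|`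
        joint_prod (draw (wf_subgame G w) i) (draw (wf_subgame G w) (opponent i)))
       (restrict w s)].
Proof.
apply/seteqP; split=> s sP w.
  by move=> _; apply/(nash_chess_likeP _ _ _ (chess_like_subgame _ _ w chessG)); apply: sP.
have [lw|nlw] := pselect (is_leaf (edge G) w).
  by apply: nash_root_leaf; apply/subnode_leaf.
by apply/(nash_chess_likeP _ _ _ (chess_like_subgame _ _ w chessG)); apply: sP.
Qed.
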